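(* Let $(X,d)$ be a complete metric space and let $f,g:X\to X$ be mappings such that $f(X)\subseteq g(X)$. Assume that $(f,g)$ is a generalized $\alpha$-$\psi$ contractive pair of mappings, with respect to functions $\alpha:X\times X\to[0,+\infty)$ and $\psi\in\Psi$, and that the following conditions hold: (i) $f$ is $\alpha$-admissible w.r.t. $g$; (ii) there exists $x_0\in X$ such that $\alpha(gx_0,fx_0)\ge 1$; (iii) if $\{gx_n\}$ is a sequence in $X$ (with $x_n \in X$) such that $\alpha(gx_n,gx_{n+1})\ge 1$ for all $n$ and $gx_n\to gz\in g(X)$ as $n\to\infty$, then there exists a subsequence $\{gx_{n(k)}\}$ of $\{gx_n\}$ such that $\alpha(gx_{n(k)},gz)\ge 1$ for all $k$. Also suppose that $g(X)$ is closed. Then $f$ and $g$ have a coincidence point, i.e. there exists $z\in X$ with $fz=gz$.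
   Context: $\Psi$ denotes the family of functions $\psi:[0,\infty)\to[0,\infty)$ that are nondecreasing and satisfy $\sum_{n=1}^{+\infty}\psi^n(t)<\infty$ for all $t>0$, where $\psi^n$ is the $n$-th iterate of $\psi$. Notation: $fx=f(x)$, $gx=g(x)$. The pair $(f,g)$ is a generalized $\alpha$-$\psi$ contractive pair of mappings if there exist $\alpha:X\times X\to[0,+\infty)$ and $\psi\in\Psi$ such that for all $x,y\in X$, $\alpha(gx,gy)\,d(fx,fy)\le\psi(M(gx,gy))$, where $M(gx,gy)=\max\left\{d(gx,gy),\frac{d(gx,fx)+d(gy,fy)}{2},\frac{d(gx,fy)+d(gy,fx)}{2}\right\}$. $f$ is $\alpha$-admissible w.r.t. $g$ if for all $x,y\in X$: $\alpha(gx,gy)\ge1\Rightarrow\alpha(fx,fy)\ge1$. *)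

(* Defs.v *)
From HB Require Import structures.
From mathcomp Require Import all_boot all_order all_algebra.
From mathcomp Require Import all_classical all_reals all_analysis.

Set Implicit Arguments.
Unset Strict Implicit.
Unset Printing Implicit Defensive.

Import Order.TTheory GRing.Theory Num.Theory.

Local Open Scope classical_set_scope.
Local Open Scope ring_scope.

#[short(type="completeMetricType")]
HB.structure Definition CompleteMetric (K : numDomainType) :=
  { M of Metric K M & Complete M }.

(* A function [0, +oo) -> [0, +oo) is represented by a function R -> R whose
   values outside [0, +oo) are unconstrained and never used.  The terms of the
   series are nonnegative, so its extended-real sum always exists and is finite
   exactly when the series converges. *)
Definition Psi (R : realType) (psi : R -> R) : Prop :=
  [/\ forall t, 0 <= t -> 0 <= psi t,
      forall s t, 0 <= s -> s <= t -> psi s <= psi t &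
      forall t, 0 < t -> (\sum_(1 <= n <oo) (iter n psi t)%:E < +oo)%E].

Section Contractive.
Context (R : realType) (X : metricType R).
Implicit Types (f g : X -> X) (alpha : X -> X -> R) (psi : R -> R) (x y : X).

(* M(gx, gy); it depends on x and y themselves through fx and fy *)
Definition Mfg f g x y : R :=
  Num.max (mdist (g x) (g y))
    (Num.max ((mdist (g x) (f x) + mdist (g y) (f y)) / 2)
             ((mdist (g x) (f y) + mdist (g y) (f x)) / 2)).

Definition contractive_pair_wrt alpha psi f g : Prop :=
  [/\ forall u v, 0 <= alpha u v, Psi psi &
      forall x y,
        alpha (g x) (g y) * mdist (f x) (f y) <= psi (Mfg f g x y)].

Definition admissible_wrt alpha f g : Prop :=
  forall x y, 1 <= alpha (g x) (g y) -> 1 <= alpha (f x) (f y).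

End Contractive.

(* Main.v *)
Require Import Defs.
From HB Require Import structures.
From mathcomp Require Import all_boot all_order all_algebra.
From mathcomp Require Import all_classical all_reals all_analysis.
From mathcomp Require Import lra.

Import Order.TTheory GRing.Theory Num.Theory.
Import numFieldNormedType.Exports.

Local Open Scope classical_set_scope.
Local Open Scope ring_scope.

(** Pick [x n] with [g (x n.+1) = f (x n)], starting from the given [x0].
    Admissibility propagates [1 <= alpha (g (x n)) (g (x n.+1))] along the
    sequence, so the contractive inequality may be used without the weight
    [alpha].  For such consecutive terms the quantity [M] is at most the larger
    of the two consecutive distances; since a function of [Psi] lies strictly
    below the identity on the positive reals ([Psi_lt]), the larger one must be
    the earlier one, and the distance from [g (x n)] to [g (x n.+1)] is at most
    the [n]-th iterate of [psi] at the initial distance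
    ([contractive_step]).  These iterates are summable, hence the sequence
    [g (x n)] is Cauchy, and its limit is some [g z] because [g(X)] is closed.

    At the limit, no continuity of [psi] is available.  Instead, if
    [D := mdist (g z) (f z)] were positive, then [M] between [x n] and [z] would
    tend to [D / 2], so [mdist (f (x n)) (f z)] would be eventually at most
    [psi (5 D / 8) < 5 D / 8] along the subsequence on which
    [1 <= alpha (g (x n)) (g z)], whereas it tends to [D]
    ([coincidence_of_approx]). *)

Section Comparison.
Context {R : realType} {psi : R -> R} (Ppsi : Psi psi).

Lemma Psi_iter_ge0 n t : 0 <= t -> 0 <= iter n psi t.
Proof. by case: Ppsi => p0 _ _ t0; elim: n => //= n; exact: p0. Qed.

Lemma Psi_series_cvg t : 0 < t -> cvgn (series (fun n => iter n psi t)).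
Proof.
move=> t0; have i0 n : 0 <= iter n psi t by apply: Psi_iter_ge0; exact: ltW.
apply: nondecreasing_is_cvgn.
  by apply: nondecreasing_series => n _ _; exact: i0.
case: (Ppsi) => _ _ /(_ _ t0) sum_lty.
have e0 n : (1 <= n)%N -> true -> (0 <= (iter n psi t)%:E)%E by rewrite lee_fin.
have sum_fin : (\sum_(1 <= n <oo) (iter n psi t)%:E)%E \is a fin_num.
  by rewrite ge0_fin_numE //; exact: nneseries_ge0.
exists (t + fine (\sum_(1 <= n <oo) (iter n psi t)%:E)%E) => _ [[|k] _ <-].
  rewrite /series /= big_geq // addr_ge0 ?(ltW t0) //.
  by apply: fine_ge0; exact: nneseries_ge0.
rewrite /series /= big_ltn // lerD2l -lee_fin fineK // -sumEFin.
exact: nneseries_lim_ge.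
Qed.

(** Otherwise monotonicity would keep all iterates above [t], and they could
    not tend to zero. *)
Lemma Psi_lt t : 0 < t -> psi t < t.
Proof.
move=> t0; case: (Ppsi) => _ mono _; rewrite ltNge; apply/negP => le_t.
have ge_t n : t <= iter n psi t.
  elim: n => //= n IH; apply: le_trans le_t _.
  exact: mono (ltW t0) IH.
have /cvg_series_cvg_0 cvg0 := Psi_series_cvg t t0.
have : t <= 0.
  have <- := cvg_lim (@Rhausdorff R) cvg0.
  by apply: limr_ge; [exact: cvgP cvg0 | exact: nearW].
by rewrite leNgt t0.
Qed.

End Comparison.

Lemma mdist_le_sum (R : realType) (X : metricType R) (y : nat -> X) m n :
  (m <= n)%N ->
  mdist (y m) (y n) <= \sum_(m <= k < n) mdist (y k) (y k.+1).
Proof.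
elim: n => [|n IH]; first by rewrite leqn0 => /eqP ->; rewrite mdistxx big_geq.
rewrite leq_eqVlt => /predU1P[->|]; first by rewrite mdistxx big_geq.
rewrite ltnS => le_mn; rewrite big_nat_recr //=.
by apply: le_trans (metric_triangle _ (y n) _) _; rewrite lerD2r IH.
Qed.

Lemma cauchy_summable_steps (R : realType) (X : metricType R) (y : nat -> X)
    (u : nat -> R) :
  cvgn (series u) -> (forall n, mdist (y n) (y n.+1) <= u n) ->
  cauchy (y @ \oo).
Proof.
move=> /cauchy_cvgP/cauchy_seriesP u_tail le_u.
have dist_lt m n (e : R) : (m <= n)%N -> `|\sum_(m <= k < n) u k| < e ->
    mdist (y m) (y n) < e.
  move=> le_mn; apply: le_lt_trans; apply: le_trans (ler_norm _).
  by apply: le_trans (mdist_le_sum _ _ _ _ _ le_mn) _; apply: ler_sum.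
apply/cauchy_ballP => e e0; rewrite near_map2.
have [[A B] /= [[N _ NA] [N' _ N'B]] AB] := u_tail _ e0.
exists ([set n | (maxn N N' <= n)%N], [set n | (maxn N N' <= n)%N]) => /=.
  by split; exists (maxn N N').
move=> [m n] /= []; rewrite !geq_max => /andP[m1 m2] /andP[n1 n2].
rewrite ballEmdist /=; case: (leqP m n) => [le_mn|/ltnW le_nm].
  by apply: dist_lt => //; apply: (AB (m, n)); split; [exact: NA|exact: N'B].
rewrite metric_sym; apply: dist_lt => //.
by apply: (AB (n, m)); split; [exact: NA|exact: N'B].
Qed.

Section ContractivePair.
Context {R : realType} {X : metricType R} {f g : X -> X}.
Context {alpha : X -> X -> R} {psi : R -> R}.
Context (fg : contractive_pair_wrt alpha psi f g).

Lemma contractive_unweighted x y : 1 <= alpha (g x) (g y) ->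
  mdist (f x) (f y) <= psi (Mfg f g x y).
Proof.
case: fg => _ _ /(_ x y) le_psi a1; apply: le_trans le_psi.
by rewrite ler_peMl ?mdist_ge0.
Qed.

(** When [g x' = f x], the last entry of [M] is half a distance bounded through
    the triangle inequality by the two consecutive ones, so [M] is at most their
    maximum; were [mdist (f x) (f x')] the larger one, it would not exceed its
    own image by [psi]. *)
Lemma contractive_step x x' : g x' = f x -> 1 <= alpha (g x) (g x') ->
  mdist (f x) (f x') <= psi (mdist (g x) (g x')).
Proof.
move=> gx' a1; have := contractive_unweighted _ _ a1.
case: (fg) => _ Ppsi _; case: (Ppsi) => _ mono _.
rewrite /Mfg gx' mdistxx addr0.
have tri := metric_triangle (g x) (f x) (f x').
have d0 := mdist_ge0 (g x) (f x); have d'0 := mdist_ge0 (f x) (f x').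
set M := Num.max _ _ => le_psiM.
have M0 : 0 <= M by rewrite le_max d0.
case: (leP (mdist (f x) (f x')) (mdist (g x) (f x))) => [le_d|lt_d].
  apply: le_trans le_psiM (mono _ _ M0 _).
  by rewrite /M !ge_max lexx /=; apply/andP; split; lra.
have le_M : M <= mdist (f x) (f x').
  by rewrite /M !ge_max ltW //=; apply/andP; split; lra.
have := le_lt_trans (le_trans le_psiM (mono _ _ M0 le_M))
                    (Psi_lt Ppsi _ (le_lt_trans d0 lt_d)).
by rewrite ltxx.
Qed.

(** With [D := mdist (g z) (f z)] and [e = D / 8], an approximation [x] as in
    the hypothesis has [M <= D / 2 + e], whence
    [D <= e + psi (D / 2 + e) < D]. *)
Lemma coincidence_of_approx z :
  (forall e, 0 < e -> exists x, [/\ 1 <= alpha (g x) (g z),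
     mdist (g z) (g x) < e & mdist (g z) (f x) < e]) ->
  f z = g z.
Proof.
move=> approx; apply/esym/eqP; rewrite -[_ == _]negbK -mdist_gt0.
apply/negP => D0; set D := mdist (g z) (f z) in D0.
have [|x [a1 gx fx]] := approx (D / 8); first by rewrite divr_gt0.
have := contractive_unweighted _ _ a1.
case: (fg) => _ Ppsi _; case: (Ppsi) => _ mono _; move=> le_psiM.
have gx0 := mdist_ge0 (g z) (g x).
have t1 := metric_triangle (g x) (g z) (f x).
have t2 := metric_triangle (g x) (g z) (f z).
have t3 := metric_triangle (g z) (f x) (f z).
rewrite (metric_sym (g x) (g z)) -/D in t1 t2 t3.
have M0 : 0 <= Mfg f g x z by rewrite le_max mdist_ge0.
have le_M : Mfg f g x z <= 5 / 8 * D.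
  rewrite /Mfg (metric_sym (g x) (g z)) -/D !ge_max.
  by apply/andP; split; [|apply/andP; split]; lra.
have lt_D : psi (5 / 8 * D) < 5 / 8 * D by apply: (Psi_lt Ppsi); lra.
have := mono _ _ M0 le_M; lra.
Qed.

End ContractivePair.

Theorem theorem3p1 (R : realType) (X : completeMetricType R) (f g : X -> X)
    (alpha : X -> X -> R) (psi : R -> R) :
  range f `<=` range g ->
  contractive_pair_wrt alpha psi f g ->
  admissible_wrt alpha f g ->
  (exists x0 : X, 1 <= alpha (g x0) (f x0)) ->
  (forall (x : nat -> X) (z : X),
     (forall n, 1 <= alpha (g (x n)) (g (x n.+1))) ->
     g (x n) @[n --> \oo] --> g z ->
     exists phi : nat -> nat,
       {homo phi : i j / (i < j)%N} /\
       forall k, 1 <= alpha (g (x (phi k))) (g z)) ->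
  closed (range g) ->
  exists z : X, f z = g z.
Proof.
move=> fXgX fg adm [x0 ax0] reg clg.
have [h gh] : {h : X -> X & forall x, g (h x) = f x}.
  by apply: (@choice _ _ (fun x y => g y = f x)) => x;
    have [y _ gy] := fXgX (f x) (imageP f I); exists y.
pose x n := iter n h x0.
have gxS n : g (x n.+1) = f (x n) by exact: gh.
have ax n : 1 <= alpha (g (x n)) (g (x n.+1)).
  elim: n => [|n IH]; first by rewrite gxS.
  by rewrite gxS [g (x n.+2)]gxS; exact: adm.
(* The series of iterates is only known to converge at positive arguments. *)
have [gfx0|] := eqVneq (g x0) (f x0); first by exists x0.
rewrite -mdist_gt0 => d0; case: (fg) => _ Ppsi _; case: (Ppsi) => _ mono _.
have step n : mdist (g (x n)) (g (x n.+1)) <= iter n psi (mdist (g x0) (f x0)).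
  elim: n => [|n IH]; first by rewrite gxS.
  rewrite gxS [g (x n.+2)]gxS /=.
  apply: le_trans (contractive_step fg _ _ (gxS n) (ax n)) _.
  by apply: mono IH; exact: mdist_ge0.
have /cauchy_cvg/cvg_ex[a gx_a] : cauchy (g (x n) @[n --> \oo]).
  exact: cauchy_summable_steps (Psi_series_cvg Ppsi _ d0) step.
have [z _ gz] : range g a.
  by apply: closed_cvg gx_a => //; apply: nearW => n; exists (x n).
rewrite -gz in gx_a.
have [phi [phi_incr aphi]] := reg x z ax gx_a.
have phi_ge n : (n <= phi n)%N.
  by elim: n => // n IH; apply: leq_ltn_trans IH _; exact: phi_incr.
exists z; apply: (coincidence_of_approx fg) => e e0.
have [N _ near_gz] := cvg_ball gx_a e0.
have {}near_gz n : (N <= n)%N -> mdist (g z) (g (x n)) < e.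
  by move=> /near_gz; rewrite /= ballEmdist.
exists (x (phi N)); split; first exact: aphi.
  exact/near_gz/phi_ge.
by rewrite -gxS; apply/near_gz/leqW/phi_ge.
Qed.
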